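(* Let $n\ge 1$, let $\pi\in S_n$, and let $\lambda$ be the shape of the insertion tableau of $\pi$. Under iteration of the map $r:S_n\to S_n$ starting from $\pi$: if $\lambda$ is self-conjugate, then the iteration results in a $1$-cycle (a fixed point of $r$); if $\lambda$ is not self-conjugate, then the iteration results in a $2$-cycle of $r$. (Here the iteration ''results in'' a cycle if some iterate $r^k(\pi)$, $k\ge 0$, lies in that cycle.)
   Context: $S_n$ is the set of permutations of $1,2,\ldots,n$, written as words $\pi=\pi_1,\ldots,\pi_n$. A Young diagram of a partition $\lambda=(\lambda_1\ge\cdots\ge\lambda_k>0)$ of $n$ is drawn in French notation: left-justified rows, with $\lambda_i$ boxes in the $i$-th row from the bottom. The transpose partition $\lambda'$ is the one whose diagram is obtained by reflecting the diagram of $\lambda$ about the diagonal starting from the bottom-left corner; $\lambda$ is self-conjugate if $\lambda'=\lambda$. A standard Young tableau (SYT) of shape $\lambda$ is a filling of the boxes with $1,\ldots,n$, each used once, with rows increasing left to right and columns increasing bottom to top. RSK: for $\pi\in S_n$, $\mathrm{RSK}(\pi)=(S,T)$, where $S$ (the insertion tableau) is obtained by starting from the empty tableau and inserting $\pi_1,\pi_2,\ldots,\pi_n$ in order. To insert $a$ into a row (starting with the bottom row): if $a$ is larger than every entry of the row, place $a$ at the end of the row and stop; otherwise $a$ replaces the leftmost entry $b$ of the row that is greater than $a$, and $b$ is then inserted into the next row up by the same rule. The recording tableau $T$ has the same shape as $S$, with the box that is newly created when inserting $\pi_i$ labeled $i$. RSK is a bijection from $S_n$ to pairs of SYT of size $n$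 of the same shape. The reading word of an SYT is the permutation obtained by concatenating its rows from the top row to the bottom row, each read left to right. The reversed reading word is the reading word written in reverse order (right to left). The map $r:S_n\to S_n$ is defined by: if $\mathrm{RSK}(\pi)=(S,T)$, then $r(\pi)$ is the reversed reading word of $T$. An $m$-cycle of a map $g:A\to A$ is a sequence $a,g(a),g^2(a),\ldots,g^m(a)$ with $g^m(a)=a$ and $m\ge1$ minimal with this property. *)

(* Defs.v *)
From mathcomp Require Import all_boot all_fingroup.
Set Implicit Arguments.
Unset Strict Implicit.
Unset Printing Implicit Defensive.

(* The word pi_1 ... pi_n of a permutation; 'S_n acts on {0, .., n-1}, so the
   letters are shifted to lie in {1, .., n}. *)
Definition word (n : nat) (p : 'S_n) : seq nat :=
  [seq (p i : nat).+1 | i <- enum 'I_n].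

(* A tableau is the sequence of its rows, the bottom row (French notation)
   coming first. *)
Notation tableau := (seq (seq nat)).

(* Row insertion. The second component is the index of the row in which the
   new box is created. *)
Fixpoint insert (a : nat) (S : tableau) : tableau * nat :=
  match S with
  | [::] => ([:: [:: a]], 0)
  | row :: S' =>
      let j := find (fun b => a < b) row in
      if j < size row then
        let: (S'', i) := insert (nth 0 row j) S' in
        (set_nth 0 row j a :: S'', i.+1)
      else (rcons row a :: S', 0)
  end.

(* The box goes to the end of row i; for i = size T this creates a new row. *)
Definition add_box (T : tableau) (i k : nat) : tableau :=
  set_nth [::] T i (rcons (nth [::] T i) k).

(* ak = (a, k), where a is the letter inserted at time k. *)
Definition rsk_step (ST : tableau * tableau) (ak : nat * nat) :
    tableau * tableau :=
  let: (S', i) := insert ak.1 ST.1 in (S', add_box ST.2 i ak.2).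

Definition rsk (w : seq nat) : tableau * tableau :=
  foldl rsk_step ([::], [::]) (zip w (iota 1 (size w))).

Definition insertion_tableau (w : seq nat) : tableau := (rsk w).1.
Definition recording_tableau (w : seq nat) : tableau := (rsk w).2.

Definition reading_word (T : tableau) : seq nat := flatten (rev T).

Definition reversed_reading_word (T : tableau) : seq nat :=
  rev (reading_word T).

Definition shape_of (T : tableau) : seq nat := [seq size row | row <- T].

(* The number of boxes in row j of the reflected diagram is the number of boxes
   in column j of the diagram; see in_diagram_transpose. *)
Definition transpose (lambda : seq nat) : seq nat :=
  [seq count (fun l => j < l) lambda | j <- iota 0 (head 0 lambda)].

Definition in_diagram (lambda : seq nat) (row col : nat) : bool :=
  col < nth 0 lambda row.

Lemma in_diagram_transpose (lambda : seq nat) (i j : nat) :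
  sorted geq lambda -> in_diagram (transpose lambda) i j = in_diagram lambda j i.
Proof.
rewrite /in_diagram /transpose => srt.
have [ilt|ige] := ltnP i (head 0 lambda).
  rewrite (nth_map 0) ?size_iota // nth_iota // add0n.
  elim: lambda srt j {ilt} => [|l s IH] /= srt j; first by rewrite nth_nil.
  have {}IH := IH (path_sorted srt).
  have [il|li] := ltnP i l; first by case: j => [|j] /=; rewrite ?il // add1n ltnS.
  have all_le : all (fun x => x <= i) s.
    apply/allP => x xs; apply: leq_trans li.
    by move: srt; rewrite path_sortedE => [/andP[/allP /(_ x xs)]|] // ? ? ?;
       apply: (rev_trans leq_trans).
  rewrite add0n (eq_in_count (a2 := pred0)) ?count_pred0; last first.
    by move=> x /(allP all_le) xi /=; rewrite ltnNge xi.
  case: j => [|j] /=; first by apply/esym/negbTE; rewrite -leqNgt.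
  have [js|js] := ltnP j (size s); last by rewrite nth_default.
  by apply/esym/negbTE; rewrite -leqNgt (allP all_le) ?mem_nth.
rewrite nth_default ?size_map ?size_iota //; symmetry; apply/negbTE.
rewrite -leqNgt; apply: leq_trans ige.
case: lambda srt => [|l s] /= srt; first by rewrite nth_nil.
case: j => [|j] //=; have [js|js] := ltnP j (size s); last by rewrite nth_default.
have := order_path_min (rev_trans leq_trans) srt.
by move/allP; apply; rewrite mem_nth.
Qed.

Lemma perm_flatten_add_box (T : tableau) (i k : nat) :
  perm_eq (flatten (add_box T i k)) (k :: flatten T).
Proof.
rewrite /add_box; elim: T i => [|row T IH] [|i] /=.
- by [].
- by elim: i => [|i IHi] //=; rewrite nth_nil in IHi *.
- by rewrite cat_rcons; apply: permEl (perm_catCA row [:: k] _).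
- apply: (@perm_trans _ (row ++ k :: flatten T)); first by rewrite perm_cat2l IH.
  exact: permEl (perm_catCA row [:: k] _).
Qed.

Lemma perm_recording_tableau (w : seq nat) :
  perm_eq (flatten (recording_tableau w)) (iota 1 (size w)).
Proof.
rewrite /recording_tableau /rsk.
have perm_foldl (s : seq (nat * nat)) ST :
    perm_eq (flatten (foldl rsk_step ST s).2) (flatten ST.2 ++ unzip2 s).
  elim: s ST => [|ak s IH] ST /=; first by rewrite cats0.
  apply: (perm_trans (IH _)); rewrite /rsk_step.
  case: (insert _ _) => S' i /=.
  have := perm_flatten_add_box ST.2 i ak.2.
  rewrite -(perm_cat2r (unzip2 s)) => /perm_trans; apply.
  by rewrite perm_sym; apply: permEl (perm_catCA _ [:: ak.2] _).
by rewrite (perm_trans (perm_foldl _ _)) // unzip2_zip ?size_iota.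
Qed.

Lemma word_surj (n : nat) (w : seq nat) :
  perm_eq w (iota 1 n) -> exists p : 'S_n, word p == w.
Proof.
move=> pw; have sw : size w = n by rewrite (perm_size pw) size_iota.
have lt_w (i : 'I_n) : (nth 0 w i).-1 < n.
  have : nth 0 w i \in w by rewrite mem_nth ?sw.
  by rewrite (perm_mem pw) mem_iota add1n; case: (nth 0 w i).
have pos_w (i : 'I_n) : 0 < nth 0 w i.
  have : nth 0 w i \in w by rewrite mem_nth ?sw.
  by rewrite (perm_mem pw) mem_iota => /andP[].
have inj : injective (fun i => Ordinal (lt_w i)).
  move=> i j [] eij; apply/val_inj/eqP.
  rewrite -(nth_uniq 0 (s := w)) ?sw ?(perm_uniq pw) ?iota_uniq ?ltn_ord //.
  by rewrite -(prednK (pos_w i)) -(prednK (pos_w j)) eij.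
exists (perm inj); apply/eqP/(@eq_from_nth _ 0).
  by rewrite size_map size_enum_ord sw.
move=> i; rewrite size_map size_enum_ord => ltin.
rewrite (nth_map (Ordinal ltin)) ?size_enum_ord // permE /=.
by rewrite prednK ?pos_w // nth_enum_ord.
Qed.

Lemma r_subproof (n : nat) (p : 'S_n) :
  exists q : 'S_n, word q == reversed_reading_word (recording_tableau (word p)).
Proof.
apply: word_surj; rewrite /reversed_reading_word /reading_word perm_rev.
have pf (T : tableau) : perm_eq (flatten (rev T)) (flatten T).
  by apply: perm_flatten; rewrite perm_rev.
apply: (perm_trans (pf _)); apply: (perm_trans (perm_recording_tableau _)).
by rewrite /word size_map size_enum_ord.
Qed.

Definition r (n : nat) (p : 'S_n) : 'S_n := xchoose (r_subproof p).

Lemma word_inj (n : nat) : injective (@word n).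
Proof.
move=> p q /eq_in_map epq; apply/permP => i; apply/val_inj.
by have [] := epq i (mem_enum _ _).
Qed.

Lemma word_r (n : nat) (p : 'S_n) :
  word (r p) = reversed_reading_word (recording_tableau (word p)).
Proof. exact/eqP/(xchooseP (r_subproof p)). Qed.

(* c is the sequence a, g a, .., g^m a (so its last entry repeats the first). *)
Definition is_cycle (A : eqType) (g : A -> A) (m : nat) (c : seq A) : Prop :=
  exists a : A,
    [/\ c = traject g a m.+1, 0 < m, iter m g a = a
      & forall j, 0 < j < m -> iter j g a <> a].

Definition results_in_cycle (A : eqType) (g : A -> A) (a : A) (m : nat) : Prop :=
  exists c : seq A, is_cycle g m c /\ exists k : nat, iter k g a \in c.

(* Main.v *)
Require Import Defs.
From mathcomp Require Import all_boot all_fingroup.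
Set Implicit Arguments.
Unset Strict Implicit.
Unset Printing Implicit Defensive.

(* The reversed reading word of a standard tableau T lists the rows of T, the
   bottom one first, each decreasingly. Inserting a decreasing row on top of
   the previous ones builds one new column, from bottom to top, so the
   recording tableau of this word depends only on the shape of T, and its shape
   is the transpose of that of T. Hence r (r p) depends only on the shape of p,
   and r transposes the shape. *)

(** * Tableaux as sequences of rows *)

(** The column condition for a row [y] lying directly above a row [x]. *)
Definition row_dom (x y : seq nat) : Prop :=
  size y <= size x /\ forall j, j < size y -> nth 0 x j < nth 0 y j.

(* Rows are e-sorted: e = leq gives semistandard tableaux (the invariant of
   insertion for arbitrary words), e = ltn suits recording tableaux. *)
Definition is_tab (e : rel nat) (T : tableau) : Prop :=
  [/\ forall i, sorted e (nth [::] T i),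
      forall i, row_dom (nth [::] T i) (nth [::] T i.+1)
    & [::] \notin T].

Lemma is_tab_nil e : is_tab e [::].
Proof. by split=> // i; rewrite !nth_nil. Qed.

Lemma is_tab_cons e x T :
  is_tab e (x :: T) <->
  [/\ sorted e x, x != [::], row_dom x (head [::] T) & is_tab e T].
Proof.
rewrite -nth0; split=> [[srt dom]|[sx x0 dx [srt dom T0]]].
  rewrite in_cons negb_or eq_sym => /andP[x0 T0]; split=> //.
  - exact: (srt 0).
  - exact: (dom 0).
  - by split=> // i; [apply: (srt i.+1) | apply: (dom i.+1)].
by split; [case | case | rewrite in_cons negb_or eq_sym x0].
Qed.

(** * Shapes and transposition of partitions *)

Lemma size_nth_shape T i : size (nth [::] T i) = nth 0 (shape_of T) i.
Proof.
have [lt|ge] := ltnP i (size T); first by rewrite (nth_map [::]).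
by rewrite !nth_default ?size_map.
Qed.

Lemma shape_neq0 T : (0 \notin shape_of T) = ([::] \notin T).
Proof. by elim: T => //= x T IH; rewrite !in_cons !negb_or IH; case: x. Qed.

Lemma is_tab_sorted_shape e T : is_tab e T -> sorted geq (shape_of T).
Proof.
case=> _ dom _; apply/(sortedP 0) => i _.
by rewrite -!size_nth_shape; case: (dom i).
Qed.

(** Since no part is [0], the default value [0] of [nth] marks the end of the list, so the lengths
    agree as well. *)
Lemma partition_ext (l m : seq nat) :
  0 \notin l -> 0 \notin m -> nth 0 l =1 nth 0 m -> l = m.
Proof.
have le_size (s t : seq nat) :
    0 \notin s -> nth 0 s =1 nth 0 t -> size s <= size t.
  move=> s0 st; rewrite leqNgt; apply: contra s0 => lt.
  by rewrite -[0](nth_default 0 (leqnn (size t))) -st mem_nth.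
move=> l0 m0 lm; apply: (@eq_from_nth _ 0) => [|i _]; last exact: lm.
by apply/eqP; rewrite eqn_leq !le_size // => i; rewrite lm.
Qed.

Lemma nth_transpose (l : seq nat) i :
  sorted geq l -> nth 0 (transpose l) i = count (fun x => i < x) l.
Proof.
move=> srt; rewrite /transpose.
have [lt|ge] := ltnP i (head 0 l).
  by rewrite (nth_map 0) ?size_iota // nth_iota.
rewrite nth_default ?size_map ?size_iota //; apply/esym/eqP.
rewrite -leqn0 leqNgt -has_count; apply/hasPn => x xl.
rewrite -leqNgt; apply: leq_trans ge.
case: l srt xl => //= y l /(order_path_min (rev_trans leq_trans))/allP le_y.
by rewrite in_cons => /predU1P[->|/le_y].
Qed.

Lemma transpose_neq0 (l : seq nat) : 0 \notin transpose l.
Proof.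
apply/mapP => -[j]; rewrite mem_iota add0n => /= lt /esym/eqP.
by rewrite -leqn0 leqNgt -has_count => /negP[]; case: l lt => //= x l ->.
Qed.

Lemma transpose_sorted (l : seq nat) :
  sorted geq l -> sorted geq (transpose l).
Proof.
move=> srt; apply/(sortedP 0) => i _ /=; rewrite !nth_transpose //.
by apply: sub_count => x /ltnW.
Qed.

(** Reflecting the diagram twice swaps the coordinates back, and a row length is determined by the
    columns that the row meets. *)
Lemma transposeK (l : seq nat) :
  sorted geq l -> 0 \notin l -> transpose (transpose l) = l.
Proof.
move=> srt l0; apply: partition_ext (transpose_neq0 _) l0 _ => i.
have lt_iff j : (j < nth 0 (transpose (transpose l)) i) = (j < nth 0 l i).
  have := in_diagram_transpose j i srt.
  by rewrite -in_diagram_transpose ?transpose_sorted.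
by apply/eqP; rewrite eqn_leq leqNgt lt_iff ltnn leqNgt -lt_iff ltnn.
Qed.

(** * Row insertion preserves tableaux *)

Lemma set_nth_size (T : Type) (x0 : T) s a :
  set_nth x0 s (size s) a = rcons s a.
Proof. by elim: s => //= x s ->. Qed.

Lemma set_nth_rcons_size (T : Type) (x0 : T) s b a :
  set_nth x0 (rcons s b) (size s) a = rcons s a.
Proof. by elim: s => //= x s ->. Qed.

Lemma shape_insert a S :
  shape_of (insert a S).1 = incr_nth (shape_of S) (insert a S).2.
Proof.
elim: S a => [|x S IH] a //=.
case: ifP => [lt|_] /=; last by rewrite size_rcons.
have := IH (nth 0 x (find (fun b => a < b) x)).
by case: insert => S' i /= ->; rewrite size_set_nth (maxn_idPr lt).
Qed.

Lemma shape_add_box T i k :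
  shape_of (add_box T i k) = incr_nth (shape_of T) i.
Proof.
rewrite /add_box; elim: T i => [|x T IH] [|i] //=.
- by elim: i => //= i ->.
- by rewrite size_rcons.
- by rewrite IH.
Qed.

(** One formula covers bumping and appending: if no letter exceeds [a], then [find] returns the
    length of the row and [set_nth] appends. *)
Lemma head_insert a S :
  let x := head [::] S in
  head [::] (insert a S).1 = set_nth 0 x (find (fun b => a < b) x) a.
Proof.
case: S => [|x S] //=; case: ifP => [_|/negbT]; first by case: insert.
rewrite -leqNgt => le; have := find_size (fun b => a < b) x.
by move=> ge; rewrite (@anti_leq (find _ _) (size x)) ?ge ?set_nth_size.
Qed.

Lemma sorted_set_nth_find a x :
  sorted leq x -> sorted leq (set_nth 0 x (find (fun b => a < b) x) a).
Proof.
have path_set y : y <= a -> path leq y x ->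
    path leq y (set_nth 0 x (find (fun b => a < b) x) a).
  elim: x y => [|z x IH] y ya /=; first by rewrite ya.
  case: ltnP => [az|za] /= /andP[yz pz]; last by rewrite yz IH.
  rewrite ya; apply: path_le pz; [exact: leq_trans | exact: ltnW].
(* The letter [0] in front serves as the lower bound that the induction on paths requires. *)
move=> srt; have := path_set 0 (leq0n a).
by case: x srt {path_set} => //= y x srt /(_ srt)/path_sorted.
Qed.

(* A letter bumped from column j enters the next row in a column j' <= j. *)
Lemma row_dom_bump a x y :
  let j := find (fun b => a < b) x in let c := nth 0 x j in
  j < size x -> row_dom x y ->
  row_dom (set_nth 0 x j a) (set_nth 0 y (find (fun b => c < b) y) c).
Proof.
move=> j c lt_j [le_yx xy]; set j' := find _ y.
have ac : a < c by apply: (nth_find 0 (a := fun b => a < b)); rewrite has_find.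
have le_j' : j' <= j.
  (* If [y] has a column [j], its letter there exceeds [c], so the search stops by then; otherwise
     [y] ends by column [j]. *)
  have [lt|ge] := ltnP j (size y); last exact: leq_trans (find_size _ _) ge.
  by rewrite leqNgt; apply/negP => /(before_find 0); rewrite xy.
split=> [|k]; rewrite !size_set_nth.
  by rewrite (maxn_idPr lt_j) geq_max le_yx (leq_ltn_trans le_j').
move=> lt_k; rewrite !nth_set_nth /=; case: (k =P j') => [->|nk].
  case: eqP => // nj.
  have {nj}lt : j' < j by rewrite ltn_neqAle le_j' andbT; apply/eqP.
  by apply: leq_ltn_trans ac; have /negbT := before_find 0 lt; rewrite -leqNgt.
have lt_ky : k < size y.
  move: lt_k; rewrite leq_max ltnS leq_eqVlt => /orP[/orP[/eqP//|lt]|//].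
  exact: leq_trans lt (find_size _ _).
(* Away from column [j'] the upper letter is unchanged, and the lower one can only drop, from [c] to
   [a]. *)
by case: eqP => [kj|_]; [apply: ltn_trans ac _; rewrite /c -kj|]; apply: xy.
Qed.

Lemma row_dom_rcons x y a : row_dom x y -> row_dom (rcons x a) y.
Proof.
case=> le xy; split=> [|j lt]; first by rewrite size_rcons leqW.
by rewrite nth_rcons (leq_trans lt le) xy.
Qed.

Lemma insert_tab a S : is_tab leq S -> is_tab leq (insert a S).1.
Proof.
elim: S a => [|x S IH] a.
  by move=> _; apply/is_tab_cons; split=> //; apply: is_tab_nil.
case/is_tab_cons=> srt x0 dom tabS; have := sorted_set_nth_find a srt.
have := head_insert a (x :: S) => /=; case: ifP => [lt|_] /=.
  move=> _ srt'; set c := nth 0 x _; have := head_insert c S; have := IH c tabS.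
  case: insert => S' i /= tabS' hS'; apply/is_tab_cons; split=> //.
    by case: (x) => [|y s] //=; case: ifP.
  by rewrite hS'; apply: row_dom_bump.
move=> <- srt'; apply/is_tab_cons; split=> //; first by case: (x).
exact: row_dom_rcons.
Qed.

(** * The recording tableau is a tableau *)

Lemma mem_flatten_nth (T : tableau) i j :
  j < size (nth [::] T i) -> nth 0 (nth [::] T i) j \in flatten T.
Proof.
have [lt|ge] := ltnP i (size T); last by rewrite nth_default.
by move=> ltj; apply/flattenP; exists (nth [::] T i); rewrite mem_nth.
Qed.

(** The tableau [S] guarantees that the enlarged diagram is still that of a partition; the order
    conditions hold because [k] exceeds all earlier labels. *)
Lemma add_box_tab S T i k :
  is_tab leq S -> shape_of S = shape_of (add_box T i k) ->
  is_tab ltn T -> all (fun x => x < k) (flatten T) ->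
  is_tab ltn (add_box T i k).
Proof.
move=> [_ domS S0] eqs [srt dom T0] /allP ltk.
have rowE h : nth [::] (add_box T i k) h =
    if h == i then rcons (nth [::] T i) k else nth [::] T h.
  by rewrite /add_box nth_set_nth.
split=> [h|h|]; last by rewrite -shape_neq0 -eqs shape_neq0.
  rewrite rowE; case: eqP => // _; have := srt i.
  have: all (fun x => x < k) (nth [::] T i).
    by apply/(all_nthP 0) => j lt; apply/ltk/mem_flatten_nth.
  case: (nth _ T i) => //= y s /andP[yk sk] ps; rewrite rcons_path ps /=.
  by have := mem_last y s; rewrite in_cons => /predU1P[->|/(allP sk)].
have le_size : size (nth [::] (add_box T i k) h.+1) <=
    size (nth [::] (add_box T i k) h).
  by rewrite !size_nth_shape -eqs -!size_nth_shape; case: (domS h).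
split=> // j; move: le_size; have [_ lt_dom] := dom h; rewrite !rowE.
(* The new box lies in both rows (absurd), in the lower, in the upper, or in neither. *)
case: (h =P i) => [<-|_]; case: eqP => [e|_].
- by have := n_Sn h; rewrite e.
- move=> _ lt; rewrite nth_rcons; case: (dom h) => le _.
  by rewrite (leq_trans lt le) lt_dom.
- rewrite size_rcons -e => le; rewrite ltnS leq_eqVlt nth_rcons.
  case/predU1P=> [->|lt]; last by rewrite lt lt_dom.
  by rewrite ltnn eqxx; apply/ltk/mem_flatten_nth.
- by move=> _; apply: lt_dom.
Qed.

Lemma rsk_tab (w : seq nat) :
  is_tab ltn (recording_tableau w) /\
  shape_of (insertion_tableau w) = shape_of (recording_tableau w).
Proof.
rewrite /recording_tableau /insertion_tableau /rsk.
(* The induction runs over all starting times [m], with every label already placed below [m]. *)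
have inv m S T : is_tab leq S -> is_tab ltn T -> shape_of S = shape_of T ->
    all (fun x => x < m) (flatten T) ->
    let ST := foldl rsk_step (S, T) (zip w (iota m (size w))) in
    is_tab ltn ST.2 /\ shape_of ST.1 = shape_of ST.2.
  elim: w m S T => [|a w IH] m S T tS tT eqs ltm //=.
  rewrite {2 4 6}/rsk_step /=; have := insert_tab a tS; have := shape_insert a S.
  case: insert => S' i /= eqs' tS'.
  have {}eqs' : shape_of S' = shape_of (add_box T i m).
    by rewrite eqs' eqs shape_add_box.
  apply: IH => //; first exact: add_box_tab eqs' _ _.
  rewrite (perm_all _ (perm_flatten_add_box T i m)) /= leqnn.
  by apply: sub_all ltm => x /ltnW.
by have [] := inv 1 [::] [::] (is_tab_nil _) (is_tab_nil _) erefl erefl.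
Qed.

(** * The rows of the new boxes determine the recording tableau *)

(** From the empty tableau this is the lattice (Yamanouchi) word of the recording tableau, with rows
    counted from [0]. *)
Fixpoint new_box_rows (S : tableau) (w : seq nat) : seq nat :=
  if w is a :: w' then
    (insert a S).2 :: new_box_rows (insert a S).1 w'
  else [::].

Definition insert_word (S : tableau) (w : seq nat) : tableau :=
  foldl (fun S a => (insert a S).1) S w.

Definition add_boxes (T : tableau) (iks : seq (nat * nat)) : tableau :=
  foldl (fun T ik => add_box T ik.1 ik.2) T iks.

Lemma new_box_rows_cat S w1 w2 :
  new_box_rows S (w1 ++ w2) =
  new_box_rows S w1 ++ new_box_rows (insert_word S w1) w2.
Proof. by elim: w1 S => //= a w1 IH S; rewrite IH. Qed.

Lemma size_new_box_rows S w : size (new_box_rows S w) = size w.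
Proof. by elim: w S => //= a w IH S; rewrite IH. Qed.

Lemma recording_tableauE w :
  recording_tableau w =
  let rows := new_box_rows [::] w in
  add_boxes [::] (zip rows (iota 1 (size rows))).
Proof.
rewrite /= size_new_box_rows.
rewrite /recording_tableau /rsk.
(* The insertion tableau [S], which also drives [new_box_rows], and the recording tableau [T], which
   also starts [add_boxes], vary separately. *)
elim: w 1 [::] {2 3}[::] => [|a w IH] m S T //=.
by rewrite {2}/rsk_step /=; case: insert => S' i /=; apply: IH.
Qed.

Lemma nth_shape_add_boxes T iks h :
  nth 0 (shape_of (add_boxes T iks)) h =
  nth 0 (shape_of T) h + count_mem h (unzip1 iks).
Proof.
elim: iks T => [|[i k] iks IH] T; first by rewrite addn0.
by rewrite /= IH shape_add_box nth_incr_nth -addnA addnCA.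
Qed.

(** * Inserting a decreasing word *)

(** The added boxes form a genuine column when the first [size x] rows of [S] have equal length, as
    happens when the rows of a tableau are inserted in turn. *)
Fixpoint add_col (x : seq nat) (S : tableau) : tableau :=
  if x is b :: x' then rcons (head [::] S) b :: add_col x' (behead S) else S.

Lemma nth_add_col x S h :
  nth [::] (add_col x S) h =
  if h < size x then rcons (nth [::] S h) (nth 0 x h) else nth [::] S h.
Proof.
elim: x S h => [|b x IH] S [|h] /=.
- by [].
- by [].
- by rewrite -nth0.
- by rewrite IH ltnS nth_behead.
Qed.

Definition col_fits (x : seq nat) (S : tableau) : Prop :=
  forall h, h < size x -> all (fun b => b < nth 0 x h) (nth [::] S h).

Lemma insert_word_rcons S w a :
  insert_word S (rcons w a) = (insert a (insert_word S w)).1.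
Proof. by rewrite /insert_word foldl_rcons. Qed.

(** The letter [a] exceeds the bottom row of [S] but not the first letter of [x] at its end, so it
    bumps exactly that letter. This repeats row by row: the column moves up one step and its top
    letter creates the box. *)
Lemma insert_add_col a x S :
  path ltn a x -> col_fits (a :: x) S ->
  insert a (add_col x S) = (add_col (a :: x) S, size x).
Proof.
have find_big s : all (fun b => b < a) s -> find (fun b => a < b) s = size s.
  move=> /allP lt; apply: hasNfind; apply/hasPn => b /lt.
  by rewrite -leqNgt => /ltnW.
elim: x a S find_big => [|b x IH] a S find_big /=.
  move=> _ /(_ 0 isT) /=; case: S => //= y S lt.
  by rewrite find_big // ltnn.
case/andP=> ab pb fit; have lt := fit 0 isT; rewrite nth0 /= in lt.
rewrite -cats1 find_cat find_big // has_find find_big // ltnn /= ab addn0.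
rewrite size_cat addn1 leqnn nth_cat ltnn subnn /= IH //=.
- by rewrite cats1 set_nth_rcons_size.
- move=> s /allP ltb; apply: hasNfind; apply/hasPn => c /ltb.
  by rewrite -leqNgt => /ltnW.
- by move=> h lth; rewrite nth_behead; apply: (fit h.+1).
Qed.

Lemma insert_rev_col x S :
  sorted ltn x -> col_fits x S ->
  insert_word S (rev x) = add_col x S /\
  new_box_rows S (rev x) = iota 0 (size x).
Proof.
elim: x => [|a x IH] //= pa fit.
have fitx : col_fits x S.
  move=> h lt; apply: sub_all (fit h (ltnW lt)) => b /ltn_trans; apply.
  by move: pa => /(pathP 0)/(_ h lt).
have [iE rE] := IH (path_sorted pa) fitx.
rewrite rev_cons insert_word_rcons iE -(cats1 (rev x)).
rewrite new_box_rows_cat rE iE /= insert_add_col //; split=> //.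
by rewrite -[0 :: _]/(iota 0 (size x).+1) -addn1 iotaD.
Qed.

(** * Recording tableaux of reversed reading words *)

(** After the bottom row [x] is inserted, row [h] of the new tableau ends in the [h]-th letter of
    [x]. The column condition in [T] puts the [h]-th letter of the next row above it, so that row
    fits in turn. *)
Lemma new_box_rows_rev_rows S T :
  is_tab ltn T -> col_fits (head [::] T) S ->
  new_box_rows S (flatten (map rev T)) = flatten (map (iota 0) (shape_of T)).
Proof.
elim: T S => [|x T IH] S //= /is_tab_cons[srt _ [le dom] tabT] fit.
have [iE rE] := insert_rev_col srt fit.
rewrite new_box_rows_cat rE iE IH // => h lt.
have lt_x := leq_trans lt le; rewrite nth_add_col lt_x all_rcons dom //=.
by apply: sub_all (fit h lt_x) => b /ltn_trans; apply; apply: dom.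
Qed.

Lemma new_box_rows_reversed_reading T :
  is_tab ltn T ->
  new_box_rows [::] (reversed_reading_word T) =
  flatten (map (iota 0) (shape_of T)).
Proof.
move=> tabT; rewrite /reversed_reading_word /reading_word.
rewrite rev_flatten map_rev revK.
by apply: new_box_rows_rev_rows => // h _; rewrite nth_nil.
Qed.

Lemma recording_reversed_reading T T' :
  is_tab ltn T -> is_tab ltn T' -> shape_of T = shape_of T' ->
  recording_tableau (reversed_reading_word T) =
  recording_tableau (reversed_reading_word T').
Proof.
move=> tT tT' eqs; rewrite !recording_tableauE.
by rewrite !new_box_rows_reversed_reading // eqs.
Qed.

(** The length of row [h] is the number of times [h] occurs in the sequence of new rows; each row of
    [T] longer than [h] contributes one occurrence. *)
Lemma shape_recording_reversed_reading T :
  is_tab ltn T ->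
  shape_of (recording_tableau (reversed_reading_word T)) =
  transpose (shape_of T).
Proof.
move=> tT; apply: partition_ext (transpose_neq0 _) _.
  by have [[_ _]] := rsk_tab (reversed_reading_word T); rewrite shape_neq0.
move=> h; rewrite nth_transpose ?(is_tab_sorted_shape tT) //.
rewrite recording_tableauE nth_shape_add_boxes nth_nil add0n.
rewrite unzip1_zip ?size_iota //.
rewrite new_box_rows_reversed_reading // count_flatten -map_comp.
rewrite -sumn_count; congr sumn; apply: eq_map => l /=.
by rewrite count_uniq_mem ?iota_uniq // mem_iota.
Qed.

(** * The action of [r] on shapes and the cycles *)

Definition perm_shape (n : nat) (p : 'S_n) : seq nat :=
  shape_of (recording_tableau (word p)).

Lemma shape_r (n : nat) (p : 'S_n) :
  perm_shape (r p) = transpose (perm_shape p).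
Proof.
have [tab _] := rsk_tab (word p).
by rewrite /perm_shape word_r shape_recording_reversed_reading.
Qed.

(** The word of [r p] is a reversed reading word, whose recording tableau depends only on the shape
    of the tableau read. *)
Lemma r_r_shape (n : nat) (p q : 'S_n) :
  perm_shape p = perm_shape q -> r (r p) = r (r q).
Proof.
move=> eqs; have [tp _] := rsk_tab (word p); have [tq _] := rsk_tab (word q).
apply: word_inj; rewrite !word_r; congr reversed_reading_word.
exact: recording_reversed_reading.
Qed.

Lemma shape_r_r (n : nat) (p : 'S_n) : perm_shape (r (r p)) = perm_shape p.
Proof.
have [tab _] := rsk_tab (word p); rewrite !shape_r transposeK //.
  exact: is_tab_sorted_shape tab.
by rewrite shape_neq0; case: tab.
Qed.

Theorem corollary4p9 (n : nat) (n_ge1 : 1 <= n) (p : 'S_n) :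
  let lambda := shape_of (insertion_tableau (word p)) in
  (transpose lambda = lambda -> results_in_cycle (@r n) p 1) /\
  (transpose lambda <> lambda -> results_in_cycle (@r n) p 2).
Proof.
have [_ ->] := rsk_tab (word p).
split=> [self|nself]; set q := r (r p).
(* Here [r p] has the same shape as [p], so applying [r] twice to either gives [q]; hence [q] is
   fixed. *)
- exists (traject (@r n) q 2); split; last by exists 2; rewrite inE eqxx.
  exists q; split=> // [|[|j] //].
  by rewrite /= /q; apply: r_r_shape; rewrite shape_r.
(* Now [q] has the shape of [p], so applying [r] twice to [q] returns [q]; a fixed [q] would have a
   self-conjugate shape. *)
- exists (traject (@r n) q 3); split; last by exists 2; rewrite inE eqxx.
  exists q; split=> // [|[|[|j]] // _].
    by rewrite /= /q; apply: r_r_shape; rewrite shape_r_r.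
  move=> /= rq; apply: nself.
  by rewrite -/(perm_shape p) -(shape_r_r p) -shape_r -/q rq.
Qed.
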